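(* If $a\in\mathbb{Q}\cap[-2,2]$ is non-zero and is the square of a rational number, then $a\notin Tri$, i.e. $a$ is not a trisection number.
   Context: Let $S\subseteq\mathbb{R}^2$ contain $(0,0)$ and $(1,0)$. A point is constructible over $S$ if it can be obtained from points of $S$ by a finite sequence of straightedge-and-compass steps: (1) given two distinct points already available, one may draw the line through them, or the circle centered at one of them and passing through the other; (2) given two lines, two circles, or a line and a circle already drawn, one may add their intersection points. $C(S)$ denotes the set of all points constructible over $S$. An angle $\alpha$ (in radians) is trisectable if $(\cos(\alpha/3),\sin(\alpha/3))\in C(\{(0,0),(1,0),(\cos\alpha,\sin\alpha)\})$. A trisection number is a real number of the form $2\cos\alpha$ with $\alpha$ trisectable; $Tri\subseteq[-2,2]$ is the set of all trisection numbers. *)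

(* Defs.v *)
From mathcomp Require Import all_boot all_order all_algebra.
From mathcomp Require Import classical_sets reals trigo.

Set Implicit Arguments.
Unset Strict Implicit.
Unset Printing Implicit Defensive.

Import Order.TTheory GRing.Theory Num.Theory.
Local Open Scope classical_set_scope.
Local Open Scope ring_scope.

Section Constructible.
Variable R : realType.
Implicit Types (P Q X : R * R) (S D E : set (R * R)).

Definition sqdist P Q : R := (Q.1 - P.1) ^+ 2 + (Q.2 - P.2) ^+ 2.

(* line and circle are only meant for P <> Q: line P P is the whole plane. *)
Definition line P Q : set (R * R) :=
  [set X | (Q.1 - P.1) * (X.2 - P.2) = (Q.2 - P.2) * (X.1 - P.1)].

Definition circle P Q : set (R * R) := [set X | sqdist P X = sqdist P Q].

(* Curves are compared as sets of points. Only distinct curves may be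
   intersected: a curve meets itself in all of its points, so allowing D = E
   would make every point of a drawn curve constructible. *)
Inductive constructible S : R * R -> Prop :=
| constructible_base X : S X -> constructible S X
| constructible_meet D E X :
    drawable S D -> drawable S E -> D <> E -> D X -> E X -> constructible S X
with drawable S : set (R * R) -> Prop :=
| drawable_line P Q :
    constructible S P -> constructible S Q -> P <> Q -> drawable S (line P Q)
| drawable_circle P Q :
    constructible S P -> constructible S Q -> P <> Q ->
    drawable S (circle P Q).

Definition trisectable (alpha : R) : Prop :=
  constructible [set (0, 0); (1, 0); (cos alpha, sin alpha)]
    (cos (alpha / 3), sin (alpha / 3)).

Definition Tri : set R := [set 2 * cos alpha | alpha in trisectable].

End Constructible.

Arguments Tri R : clear implicits.

(* Main.v *)
(* With a = b^2 and x = 2 cos (alpha / 3), one has x^3 - 3 x = b^2.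

   By Zorn, choose a subfield G of the reals maximal among those containing no
   root of X^3 - 3 X - a.  If such a cubic has a root in a quadratic extension
   G(z), it has one in G, so maximality makes G closed under real square roots;
   G then contains the coordinates of every point constructible over (0,0),
   (1,0), (cos alpha, sin alpha), hence x would lie in G.

   The maximal G exists as soon as the rationals contain no root, that is, as
   soon as the elliptic curve y^2 = x^3 - 3 x has no rational point with y != 0.
   A 2-descent reduces this to M^4 = 3 e^4 + N^2 having no coprime solution with
   e != 0, which is Fermat's infinite descent. *)
Require Import Defs.
From mathcomp Require Import all_boot all_order all_algebra.
From mathcomp Require Import boolp classical_sets reals trigo.
From mathcomp Require Import zify ring lra.

Set Implicit Arguments.
Unset Strict Implicit.
Unset Printing Implicit Defensive.

Import Order.TTheory GRing.Theory Num.Theory.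

(** * Infinite descent *)

(** Put [g = gcdn a c], [a = a' * g] and [c = c' * g], so that [a' * b = g ^ n * c' ^ n.+1]. Since
    [a'] is coprime to [c'] and [g] to [b], the numbers [a'] and [g ^ n] divide each other. *)
Lemma coprime_mul_expn n a b c :
  coprime a b -> a * b = c ^ n.+1 -> exists d, a = d ^ n.+1.
Proof.
move=> cop_ab; have [->|a_gt0] := posnP a; first by exists 0; rewrite exp0n.
pose g := gcdn a c; have g_gt0 : 0 < g by rewrite gcdn_gt0 a_gt0.
have cop_gb : coprime g b := coprime_dvdl (dvdn_gcdl a c) cop_ab.
have [a' aE] := dvdnP (dvdn_gcdl a c); have [c' cE] := dvdnP (dvdn_gcdr a c).
have gE : gcdn a c = g by []; rewrite gE in aE cE; clearbody g => abE; exists g.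
have cop_ac : coprime a' c'.
  by rewrite /coprime -(eqn_pmul2r g_gt0) muln_gcdl -aE -cE gE mul1n.
have a'E : a' * b = g ^ n * c' ^ n.+1.
  apply/eqP; rewrite -(eqn_pmul2r g_gt0) mulnAC -aE abE cE expnMn (expnSr g).
  by apply/eqP; ring.
suff a'g : a' = g ^ n by rewrite aE a'g expnSr.
apply/eqP; rewrite eqn_dvd -(Gauss_dvdl _ (coprimeXr n.+1 cop_ac)) -a'E.
by rewrite dvdn_mulr // -(Gauss_dvdl _ (coprimeXl n cop_gb)) a'E dvdn_mulr.
Qed.

Lemma sqrn_mod8 n : odd n -> n ^ 2 %% 8 = 1.
Proof.
move=> n_odd; rewrite -modnXm.
have: odd (n %% 8) by lia.
have: n %% 8 < 8 by rewrite ltn_mod.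
by move: (n %% 8) => m; do 8?[case: m => [//|m]].
Qed.

Lemma sqrn_mod3 n : n ^ 2 %% 3 = ~~ (3 %| n).
Proof.
rewrite /dvdn -modnXm; have: n %% 3 < 3 by rewrite ltn_mod.
by move: (n %% 3) => m; do 3![case: m => [//|m]].
Qed.

Lemma dvd3_sum_sqr x y : 3 %| x ^ 2 + y ^ 2 -> 3 %| x /\ 3 %| y.
Proof.
by rewrite {1}/dvdn -modnDm !sqrn_mod3; case: (3 %| x); case: (3 %| y).
Qed.

Lemma expn4 x : x ^ 4 = (x ^ 2) ^ 2. Proof. by rewrite -expnM. Qed.

Lemma sqrn_addDl n u c : (n + 2 * u) ^ 2 = n ^ 2 + 4 * c -> u * (n + u) = c.
Proof. by rewrite -!mulnn; lia. Qed.

(* Factor 12 s^4 = (M - r^2) (M + r^2). *)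
Lemma quartic_descent_step M r s : odd M -> odd r -> coprime M (3 * s) ->
  M ^ 2 = r ^ 4 + 12 * s ^ 4 ->
  exists al be, [/\ coprime al be, be ^ 4 %| s ^ 4 , (be = 0 -> s = 0)
     & al ^ 4 = 3 * be ^ 4 + r ^ 2].
Proof.
move=> M_odd r_odd copM ME.
have r2_odd : odd (r ^ 2) by rewrite oddX r_odd orbT.
have r2_le : r ^ 2 <= M by rewrite -(leq_exp2r _ _ (isT : 0 < 2)) -expn4; lia.
pose u := (M - r ^ 2)./2; have ME2 : M = r ^ 2 + 2 * u by lia.
pose v := r ^ 2 + u; have vE : v = r ^ 2 + u by [].
have uvE : u * v = 3 * s ^ 4.
  by apply: sqrn_addDl; rewrite -ME2 ME expn4; lia.
have cop_uv : coprime u v.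
  have: coprime u M.
    apply: (@coprime_dvdl _ (3 * s ^ 4)); first by rewrite -uvE dvdn_mulr.
    move: copM; rewrite coprime_sym 2!coprimeMl => /andP[-> cs].
    by rewrite coprimeXl.
  by rewrite (_ : M = u + v) /coprime ?gcdnDl //; lia.
(* Of the coprime factors, one is a fourth power and the other three times one. If 3 divides [u],
   then [v = r ^ 2 + u] is the equation sought. *)
have : 3 %| u * v by rewrite uvE dvdn_mulr.
rewrite Euclid_dvdM // => /orP[] /dvdnP[w wE].
  have wvE : w * v = s ^ 4 by move: uvE; rewrite wE; lia.
  have cop_wv : coprime w v by move: cop_uv; rewrite wE coprimeMl => /andP[].
  have [be beE] := coprime_mul_expn cop_wv wvE.
  have [al alE] : exists al, v = al ^ 4.
    by apply: (@coprime_mul_expn _ v w s); rewrite 1?coprime_sym // mulnC.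
  exists al, be; split; last by lia.
  - by move: cop_wv; rewrite beE alE coprime_sym coprime_pexpl // coprime_pexpr.
  - by rewrite -beE -wvE dvdn_mulr.
  - move=> be0; move: wvE; rewrite beE be0 mul0n => /esym/eqP.
    by rewrite expn_eq0 => /andP[/eqP].
have wuE : u * w = s ^ 4 by move: uvE; rewrite wE; lia.
have cop_wu : coprime u w by move: cop_uv; rewrite wE coprimeMr => /andP[].
have [be beE] := coprime_mul_expn cop_wu wuE.
(* Here [v = r ^ 2 + be ^ 4] is a sum of two squares divisible by 3, so 3 divides [be], hence both
   [u] and [v]. *)
have: 3 %| (be ^ 2) ^ 2 + r ^ 2 by rewrite -expn4 -beE addnC -vE wE dvdn_mull.
move/dvd3_sum_sqr=> [d3 _].
have: 3 %| gcdn u v.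
  by rewrite dvdn_gcd wE dvdn_mull // beE andbT expn4 dvdn_exp.
by rewrite (eqP cop_uv).
Qed.

(* Factor 3 e^4 = (M^2 - N) (M^2 + N); the step produces a smaller solution
   be of the same equation, dividing e / 2. *)
Lemma quartic_descent M e N : coprime M e -> M ^ 4 = 3 * e ^ 4 + N ^ 2 -> e = 0.
Proof.
have [k] := ubnP e; elim: k M e N => // k IHk M e N /ltnSE le_ek cop_Me ME.
have [//|e_gt0] := posnP e.
have cop_M3 : coprime M 3.
  rewrite coprime_sym prime_coprime //; apply/negP => d3M.
  have d3N : 3 %| N.
    have: 3 %| N ^ 2.
      by rewrite -(@dvdn_addr (3 * e ^ 4)) ?dvdn_mulr // -ME dvdn_exp.
    by rewrite Euclid_dvdX // => /andP[].
  have: 3 * 3 %| 3 * e ^ 4.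
    rewrite -(@dvdn_addl (N ^ 2)) -?ME.
      by rewrite expn4 -mulnn dvdn_mul // dvdn_exp.
    by rewrite -mulnn dvdn_mul.
  rewrite dvdn_pmul2l // Euclid_dvdX // => /andP[d3e _].
  have: 3 %| gcdn M e by rewrite dvdn_gcd d3M.
  by rewrite (eqP cop_Me).
(* Work modulo 8 with [e] odd: if [M] is odd, [N ^ 2] would be 6; if [M] is even, the right side is
   3 + 1 while [M ^ 4] is 0. *)
have e_even : ~~ odd e.
  apply/negP => e_odd.
  have e4 : e ^ 4 %% 8 = 1 by rewrite expn4 sqrn_mod8 // oddX.
  have [M_odd|M_even] := boolP (odd M).
    have M4 : M ^ 4 %% 8 = 1 by rewrite expn4 sqrn_mod8 // oddX.
    have: odd N = false by have := congr1 odd ME; rewrite oddD oddM !oddX; lia.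
    move/negbT; rewrite -dvdn2 => /dvdnP[n nE].
    move: ME; rewrite nE expnMn; move: (n ^ 2) => n2; lia.
  have N_odd : odd N by have := congr1 odd ME; rewrite oddD oddM !oddX; lia.
  have := sqrn_mod8 N_odd.
  move: M_even; rewrite -dvdn2 => /dvdnP[m mE].
  move: ME; rewrite mE expnMn; move: (m ^ 4) => m4; lia.
have M_odd : odd M.
  rewrite -[odd M]negbK -dvdn2; apply/negP => d2M.
  have: 2 %| gcdn M e by rewrite dvdn_gcd d2M dvdn2.
  by rewrite (eqP cop_Me).
have M2_odd : odd (M ^ 2) by rewrite oddX M_odd orbT.
have N_odd : odd N by have := congr1 odd ME; rewrite oddD oddM !oddX; lia.
move: e_even; rewrite -dvdn2 => /dvdnP[f fE].
have f4E : e ^ 4 = 16 * f ^ 4 by rewrite fE expnMn mulnC.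
have N_le : N <= M ^ 2 by rewrite -(leq_exp2r _ _ (isT : 0 < 2)) -expn4; lia.
pose u0 := (M ^ 2 - N)./2; pose v0 := N + u0.
have uv0D : u0 + v0 = M ^ 2 by lia.
have uv0M : u0 * v0 = 12 * f ^ 4.
  apply: sqrn_addDl; rewrite (_ : N + 2 * u0 = M ^ 2); last by lia.
  by rewrite -expn4 ME f4E; lia.
have cop_M3f : coprime M (3 * f).
  by rewrite coprimeMr cop_M3 (coprime_dvdr _ cop_Me) // fE dvdn_mulr.
have cop_uv0 : coprime u0 v0.
  have: coprime u0 (M ^ 2).
    apply: (@coprime_dvdl _ (12 * f ^ 4)); first by rewrite -uv0M dvdn_mulr.
    rewrite coprime_sym coprimeXl //.
    move: cop_M3f; rewrite 2!coprimeMr => /andP[_ cop_Mf].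
    rewrite (coprimeXr 4 cop_Mf) (_ : 12 = 2 ^ 2 * 3) // coprimeMr cop_M3.
    by rewrite coprimeXr // coprimen2.
  by rewrite -uv0D /coprime gcdnDl.
clearbody v0; clearbody u0.
(* The even one of the coprime factors absorbs the whole 4 of [12 * f ^ 4]. Sum and product are
   symmetric, so either factor may be the one written [4 * u]. *)
have [u [v [cop_uv uvD uvM]]] : exists u v,
  [/\ coprime u v, 4 * u + v = M ^ 2 & u * v = 3 * f ^ 4].
  have key u v : ~~ odd u -> coprime u v -> u + v = M ^ 2 ->
      u * v = 12 * f ^ 4 -> exists u v,
      [/\ coprime u v, 4 * u + v = M ^ 2 & u * v = 3 * f ^ 4].
    move=> u_even cop_uv uvD uvM.
    have: 4 %| u.
      have cop4v : coprime 4 v by rewrite (@coprimeXl 2 2) // coprime2n; lia.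
      rewrite -(Gauss_dvdl _ cop4v) uvM; lia.
    move=> /dvdnP[w wE]; exists w, v; split; try by lia.
    by move: cop_uv; rewrite wE coprimeMl => /andP[].
  have [u_odd|u_even] := boolP (odd u0); last exact: (key u0 v0).
  apply: (key v0 u0); rewrite 1?coprime_sym // 1?addnC // 1?mulnC //; lia.
(* If 3 divides [u], then [u = 3 * s ^ 4] and [v = r ^ 4]; the descent step yields [be] dividing
   [f], hence smaller than [e = 2 * f]. *)
have : 3 %| u * v by rewrite uvM dvdn_mulr.
rewrite Euclid_dvdM // => /orP[] /dvdnP[w wE].
  have wvE : w * v = f ^ 4 by move: uvM; rewrite wE; lia.
  have cop_wv : coprime w v by move: cop_uv; rewrite wE coprimeMl => /andP[].
  have [s sE] := coprime_mul_expn cop_wv wvE.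
  have [r rE] : exists r, v = r ^ 4.
    by apply: (@coprime_mul_expn _ v w f); rewrite 1?coprime_sym // mulnC.
  have ME' : M ^ 2 = r ^ 4 + 12 * s ^ 4 by lia.
  have ds : s ^ 4 %| f ^ 4 by rewrite -sE -wvE dvdn_mulr.
  have [||al [be [cop d4 be0 alE]]] := @quartic_descent_step M r s M_odd _ _ ME'.
  - by have := congr1 odd ME'; rewrite oddX M_odd oddD (oddM 12) oddX addbF.
  - apply: coprime_dvdr cop_M3f; rewrite dvdn_mul //.
    by rewrite -(dvdn_pexp2r _ _ (isT : 0 < 4)).
  suff /be0 s0 : be = 0.
    move: wvE; rewrite sE s0 mul0n => /esym/eqP.
    by rewrite expn_eq0 => /andP[/eqP f0 _]; rewrite fE f0.
  apply: (IHk al be r) => //.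
  have := dvdn_trans d4 ds; rewrite dvdn_pexp2r // => /dvdn_leq.
  by clear -e_gt0 fE le_ek; lia.
have wuE : u * w = f ^ 4 by move: uvM; rewrite wE; lia.
have cop_wu : coprime u w by move: cop_uv; rewrite wE coprimeMr => /andP[].
have [s sE] := coprime_mul_expn cop_wu wuE.
have [r rE] : exists r, w = r ^ 4.
  by apply: (@coprime_mul_expn _ w u f); rewrite 1?coprime_sym // mulnC.
(* With [M] and [r] odd, the left side is 1 and the right side 3 modulo 4. *)
have ME' : M ^ 2 = 4 * s ^ 4 + 3 * r ^ 4 by lia.
have r_odd : odd r.
  by have := congr1 odd ME'; rewrite oddX M_odd oddD (oddM 4) (oddM 3) 2!oddX => /= <-.
have r4 : r ^ 4 %% 8 = 1 by rewrite expn4 sqrn_mod8 // oddX r_odd orbT.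
by have := sqrn_mod8 M_odd; lia.
Qed.

(** * Rational points on the curve y^2 = x^3 - 3x *)

Lemma pairwise_coprime_mul_expn n a b c d :
  coprime a b -> coprime a c -> coprime b c -> a * b * c = d ^ n.+1 ->
  exists x y z, [/\ a = x ^ n.+1, b = y ^ n.+1 & c = z ^ n.+1].
Proof.
move=> ab ac bc abcE.
have [x xE] : exists x, a = x ^ n.+1.
  by apply: (@coprime_mul_expn n a (b * c) d); rewrite ?coprimeMr ?ab // mulnA.
have [y yE] : exists y, b = y ^ n.+1.
  apply: (@coprime_mul_expn n b (a * c) d); first by rewrite coprimeMr coprime_sym ab.
  by rewrite mulnCA mulnA.
have [z zE] : exists z, c = z ^ n.+1.
  apply: (@coprime_mul_expn n c (a * b) d); last by rewrite mulnC.
  by rewrite coprimeMr ![coprime c _]coprime_sym ac.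
by exists x, y, z.
Qed.

Lemma coprime_diff a b c : a = c + b \/ b = c + a -> coprime a b ->
  coprime a c /\ coprime b c.
Proof.
case=> ->; rewrite /coprime.
  by rewrite (gcdnC (c + b) b) (gcdnC (c + b) c) gcdnDr gcdnDl (gcdnC c b) => ->.
by rewrite (gcdnC (c + a) c) gcdnDr gcdnDl (gcdnC c a) => ->.
Qed.

(* Here x = +-m/q lies on y^2 = x^3 - 3x, with D = |m^2 - 3 q^2|. *)
Lemma no_coprime_solution m q D n : coprime m q -> 0 < n -> m * D * q = n ^ 2 ->
  m ^ 2 = D + 3 * q ^ 2 \/ 3 * q ^ 2 = D + m ^ 2 -> False.
Proof.
move=> cop_mq n_gt0 nE DE.
have : 0 < m * D * q by rewrite nE expn_gt0 n_gt0.
rewrite !muln_gt0 => /andP[/andP[m_gt0 D_gt0] q_gt0].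
(* If 3 does not divide [m], the factors [m], [D], [q] are pairwise coprime, hence squares. One sign
   gives the quartic of the descent; the other makes [3 * q ^ 2] a sum of two squares, forcing 3 to
   divide [m]. *)
have [d3m|nd3m] := boolP (3 %| m); last first.
  have cop_m3q : coprime (m ^ 2) (3 * q ^ 2).
    by rewrite coprimeXl // coprimeMr coprimeXr // andbT coprime_sym prime_coprime.
  have [cop_mD cop_qD] : coprime m D /\ coprime q D.
    have [] := coprime_diff DE cop_m3q.
    by rewrite coprimeMl !coprime_pexpl // => -> /andP[].
  have [x [y [z [mE DE' qE]]]] := pairwise_coprime_mul_expn cop_mD cop_mq
    (etrans (coprime_sym _ _) cop_qD) nE.
  case: DE => E.
    suff z0 : z = 0 by move: q_gt0; rewrite qE z0.
    apply: (@quartic_descent x z y); last by rewrite !expn4 -mE -qE -DE'; lia.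
    by move: cop_mq; rewrite mE qE coprime_pexpl // coprime_pexpr.
  have : 3 %| y ^ 2 + m ^ 2 by rewrite -DE' -E dvdn_mulr.
  by move/dvd3_sum_sqr => [_]; rewrite (negbTE nd3m).
(* Dividing [m], [D] and [n] by 3 gives a similar system in [w], [C], [q], again pairwise coprime.
   Now one sign forces 3 to divide [q], and the other gives the quartic with the roles of the two
   variables exchanged. *)
have [w mE] := dvdnP d3m.
have nd3q : ~~ (3 %| q).
  apply/negP => d3q; have : 3 %| gcdn m q by rewrite dvdn_gcd d3m.
  by rewrite (eqP cop_mq).
have d3D : 3 %| D.
  have d3m2 : 3 %| m ^ 2 by rewrite dvdn_exp.
  case: DE => E; first by rewrite -(@dvdn_addl (3 * q ^ 2)) -?E // dvdn_mulr.
  by rewrite -(@dvdn_addl (m ^ 2)) // -E dvdn_mulr.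
have [C DC] := dvdnP d3D.
have d3n : 3 %| n.
  have : 3 %| n ^ 2 by rewrite -nE mE -mulnA dvdn_mulr // dvdn_mull.
  by rewrite Euclid_dvdX // => /andP[].
have [k nk] := dvdnP d3n.
have kE : w * C * q = k ^ 2.
  by apply/eqP; rewrite -(eqn_pmul2l (isT : 0 < 9)); apply/eqP; move: nE;
     rewrite mE DC nk -!mulnn; lia.
have CE : 3 * w ^ 2 = C + q ^ 2 \/ q ^ 2 = C + 3 * w ^ 2.
  by case: DE => E; [left|right]; move: E; rewrite mE DC -!mulnn; lia.
have cop_wq : coprime w q by move: cop_mq; rewrite mE coprimeMl => /andP[].
have [cop_wC cop_qC] : coprime w C /\ coprime q C.
  have cop_3wq : coprime (3 * w ^ 2) (q ^ 2).
    by rewrite coprimeXr // coprimeMl coprimeXl // andbT prime_coprime.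
  have [] := coprime_diff CE cop_3wq.
  by rewrite coprimeMl !coprime_pexpl // => /andP[_ ->].
have [x [y [z [wE yE qE]]]] := pairwise_coprime_mul_expn cop_wC cop_wq
  (etrans (coprime_sym _ _) cop_qC) kE.
case: CE => E.
  have : 3 %| y ^ 2 + q ^ 2 by rewrite -yE -E dvdn_mulr.
  by move/dvd3_sum_sqr => [_]; rewrite (negbTE nd3q).
have x0 : x = 0.
  apply: (@quartic_descent z x y); last by rewrite !expn4 -wE -qE -yE; lia.
  by move: cop_wq; rewrite wE qE coprime_sym coprime_pexpl // coprime_pexpr.
by move: m_gt0; rewrite mE wE x0.
Qed.

Local Open Scope classical_set_scope.
Local Open Scope ring_scope.

(** Clearing denominators in [x = p / q] and [b = r / s] makes [p * d * q] the square of the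
    rational [q ^+ 2 * r / s], which is then an integer. Absolute values move this to naturals, the
    sign of [d] selecting the alternative. *)
Lemma no_rational_point (x b : rat) : b != 0 -> x ^+ 3 - 3 * x <> b ^+ 2.
Proof.
move=> b_neq0 xb.
pose p := numq x; pose q := denq x; pose r := numq b; pose s := denq b.
pose d := p ^+ 2 - 3 * q ^+ 2.
have q_gt0 : (0 < q)%R by exact: denq_gt0.
have eqZ : s ^+ 2 * (p * d * q) = (q ^+ 2 * r) ^+ 2.
  apply: (@intr_inj rat); rewrite !(rmorphM, rmorphXn, rmorphB) /=.
  move: xb; rewrite -{1 2}(divq_num_den x) -{1}(divq_num_den b) -/p -/q -/r -/s.
  have : q%:~R != 0 :> rat by rewrite intr_eq0 gt_eqF.
  have : s%:~R != 0 :> rat by rewrite intr_eq0 denq_neq0.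
  move: (p%:~R) (q%:~R) (r%:~R) (s%:~R) => P Q U S S0 Q0 E.
  have {}E : P * (P ^+ 2 - 3 * Q ^+ 2) * S ^+ 2 = U ^+ 2 * Q ^+ 3.
    transitivity (((P / Q) ^+ 3 - 3 * (P / Q)) * (Q ^+ 3 * S ^+ 2)).
      by field.
    by rewrite E; field.
  transitivity (P * (P ^+ 2 - 3 * Q ^+ 2) * S ^+ 2 * Q); first by ring.
  by rewrite E; ring.
have := congr1 absz eqZ; rewrite !(abszM, abszX) => eqN.
have s_gt0 : (0 < `|s|)%N by rewrite absz_gt0 denq_neq0.
have : (`|s| %| `|q| ^ 2 * `|r|)%N.
  by rewrite -(dvdn_pexp2r _ _ (isT : (0 < 2)%N)) -eqN dvdn_mulr.
move=> /dvdnP[n nE].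
have Dpq : d = p ^+ 2 - 3 * q ^+ 2 by [].
apply: (@no_coprime_solution `|p|%N `|q|%N `|d|%N n).
- exact: coprime_num_den.
- rewrite lt0n; apply/negP => /eqP n0; move: nE; rewrite n0 mul0n => /eqP.
  by rewrite muln_eq0 expn_eq0 !absz_eq0 numq_eq0 (negbTE b_neq0) gt_eqF.
- apply/eqP; rewrite -(eqn_pmul2l (_ : 0 < `|s| ^ 2)%N) ?expn_gt0 ?s_gt0 //.
  by rewrite eqN nE expnMn mulnC.
- clear -Dpq; clearbody d; clearbody p q.
  by have [le|/ltW le] := leP (3 * q ^+ 2) (p ^+ 2); [left|right]; lia.
Qed.

(** * Subfields and constructible points *)

Section Constructible.
Variable R : realType.
Implicit Types (G : set R) (P Q X : R * R).

(* The empty set is allowed, so that the union of an empty chain qualifies. *)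
Definition subfield G := [/\ forall x, G x -> G 1,
  forall x y, G x -> G y -> G (x - y), forall x y, G x -> G y -> G (x * y)
  & forall x, G x -> G x^-1].

Definition quadratically_closed G := forall z, G (z ^+ 2) -> G z.

(** This is the field [G(z)] when [G] is a field containing [z ^+ 2]. *)
Definition adjoin_sqrt G z : set R :=
  [set w | exists u v, [/\ G u, G v & w = u + v * z]].

Section Subfield.
Variables (G : set R) (Gsub : subfield G) (G1 : G 1).

Lemma subfieldB x y : G x -> G y -> G (x - y).
Proof. by case: Gsub => _ + _ _; apply. Qed.
Lemma subfieldM x y : G x -> G y -> G (x * y).
Proof. by case: Gsub => _ _ + _; apply. Qed.
Lemma subfieldV x : G x -> G x^-1.
Proof. by case: Gsub => _ _ _; apply. Qed.
Lemma subfield0 : G 0.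
Proof. by rewrite -(subrr 1); exact: subfieldB. Qed.
Lemma subfieldN x : G x -> G (- x).
Proof. by move=> Gx; rewrite -sub0r; apply: subfieldB => //; exact: subfield0. Qed.
Lemma subfieldD x y : G x -> G y -> G (x + y).
Proof. by move=> Gx Gy; rewrite -(opprK y); apply/subfieldB/subfieldN. Qed.
Lemma subfield_div x y : G x -> G y -> G (x / y).
Proof. by move=> Gx Gy; apply/subfieldM/subfieldV. Qed.
Lemma subfieldX x n : G x -> G (x ^+ n).
Proof.
by move=> Gx; elim: n => [|n IHn]; rewrite ?expr0 // exprS; exact: subfieldM.
Qed.
Lemma subfield_nat n : G n%:R.
Proof.
by elim: n => [|n IHn]; [exact: subfield0 | rewrite -addn1 natrD; exact: subfieldD].
Qed.
Lemma subfield_int (m : int) : G m%:~R.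
Proof. by case: m => n; [|apply: subfieldN]; exact: subfield_nat. Qed.
Lemma subfield_ratr (q : rat) : G (ratr q).
Proof. by apply: subfield_div; exact: subfield_int. Qed.

End Subfield.

Ltac infield Gsub G1 :=
  repeat first [exact: G1 | assumption | exact: (subfield0 Gsub G1)
   | apply: (subfieldB Gsub) | apply: (subfieldN Gsub G1)
   | apply: (subfieldD Gsub G1) | apply: (subfieldX Gsub G1)
   | apply: (subfield_div Gsub) | apply: (subfieldM Gsub)
   | apply: (subfieldV Gsub) | exact: (subfield_nat Gsub G1)].

Lemma subfield_adjoin_sqrt G z : subfield G -> G 1 -> G (z ^+ 2) -> ~ G z ->
  subfield (adjoin_sqrt G z).
Proof.
move=> Gsub G1 Gz2 nGz; split.
- by move=> _ _; exists 1, 0; split; infield Gsub G1; rewrite mul0r addr0.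
- move=> _ _ [u [v [Gu Gv ->]]] [u' [v' [Gu' Gv' ->]]].
  by exists (u - u'), (v - v'); split; infield Gsub G1; ring.
- move=> _ _ [u [v [Gu Gv ->]]] [u' [v' [Gu' Gv' ->]]].
  exists (u * u' + v * v' * z ^+ 2), (u * v' + v * u').
  by split; infield Gsub G1; ring.
move=> _ [u [v [Gu Gv ->]]].
(* The inverse is obtained by multiplying by the conjugate [u - v * z]. As [z] is not in [G], the
   conjugate vanishes only for [u = v = 0], where the inverse is 0 by convention. *)
have [uvz0|uvz_neq0] := eqVneq (u - v * z) 0.
  have [v0|v_neq0] := eqVneq v 0.
    exists 0, 0; split; infield Gsub G1.
    have u0 : u = 0 by move: uvz0; rewrite v0 mul0r subr0.
    by rewrite u0 v0 !mul0r addr0 invr0.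
  case: nGz; have -> : z = u / v; last by infield Gsub G1.
  by apply: (mulfI v_neq0); rewrite mulrCA divff // mulr1; lra.
have [uvz0|uvzD_neq0] := eqVneq (u + v * z) 0.
  by rewrite uvz0 invr0; exists 0, 0; split; infield Gsub G1; rewrite mul0r addr0.
exists (u / (u ^+ 2 - v ^+ 2 * z ^+ 2)), (- v / (u ^+ 2 - v ^+ 2 * z ^+ 2)).
split; infield Gsub G1.
have -> : u ^+ 2 - v ^+ 2 * z ^+ 2 = (u - v * z) * (u + v * z) by ring.
transitivity ((u - v * z) / ((u - v * z) * (u + v * z))); last by ring.
by rewrite invfM mulrA divff // mul1r.
Qed.

(* Roots 2 cos (alpha / 3) for a = 2 cos alpha. *)
Definition trisection_root (a x : R) := x ^+ 3 - 3 * x = a.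

(* If u + v z is a root with v != 0, so is its conjugate u - v z, hence so is
   -2u, the three roots having sum 0. *)
Lemma trisection_root_adjoin_sqrt G a z : subfield G -> G 1 -> G a ->
  G (z ^+ 2) -> ~ G z -> (exists2 x, adjoin_sqrt G z x & trisection_root a x) ->
  exists2 x, G x & trisection_root a x.
Proof.
move=> Gsub G1 Ga Gz2 nGz [_ [u [v [Gu Gv ->]]] root_uv].
(* [p] and [q] are the coordinates, on 1 and [z], of the cubic evaluated at [u + v * z]; both vanish
   since [z] is not in [G]. *)
pose p := u ^+ 3 + 3 * u * v ^+ 2 * z ^+ 2 - 3 * u - a.
pose q := 3 * u ^+ 2 * v + v ^+ 3 * z ^+ 2 - 3 * v.
have pqE : p + q * z = 0.
  have : (u + v * z) ^+ 3 - 3 * (u + v * z) - a = 0 by rewrite root_uv subrr.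
  by move=> <-; rewrite /p /q; ring.
have Gp : G p by rewrite /p; infield Gsub G1.
have Gq : G q by rewrite /q; infield Gsub G1.
have q0 : q = 0.
  apply/eqP/negP => /negP q_neq0; apply: nGz; have -> : z = - p / q.
    by apply: (mulfI q_neq0); rewrite mulrCA divff // mulr1; lra.
  by infield Gsub G1.
have p0 : p = 0 by move: pqE; rewrite q0 mul0r addr0.
have [v0|v_neq0] := eqVneq v 0.
  by exists u => //; move: root_uv; rewrite v0 mul0r addr0.
exists (- (2 * u)); first by infield Gsub G1.
have v2z2 : v ^+ 2 * z ^+ 2 = 3 - 3 * u ^+ 2.
  by apply: (mulfI v_neq0); apply/eqP; rewrite -subr_eq0 -q0 /q; apply/eqP; ring.
move: p0; rewrite /p -mulrA v2z2 /trisection_root => p0.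
by apply/eqP; rewrite -subr_eq0 -p0; apply/eqP; ring.
Qed.

(** * A maximal subfield without roots of the cubic *)

Lemma exists_quadratically_closed_subfield (a : rat) :
  (forall x : rat, x ^+ 3 - 3 * x <> a) ->
  exists G, [/\ subfield G, G 1, quadratically_closed G &
    forall x, G x -> ~ trisection_root (ratr a) x].
Proof.
move=> no_root.
pose rootfree G := subfield G /\ forall x, G x -> ~ trisection_root (ratr a) x.
have [F Ffree Ftot|G [[Gsub Gfree] Gmax]] := @Zorn_bigcup R rootfree.
  (* In the union of a chain, any two elements already lie in a single member, where differences and
     products can be formed. *)
  have common x y A B : F A -> F B -> A x -> B y -> exists C, [/\ F C, C x & C y].
    move=> FA FB Ax By; have [AB|BA] := Ftot _ _ FA FB.
      by exists B; split=> //; exact: AB.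
    by exists A; split=> //; exact: BA.
  split; last by move=> x [A FA Ax]; have [_] := Ffree _ FA; apply.
  split.
  - by move=> x [A FA Ax]; exists A => //; have [[one _ _ _] _] := Ffree _ FA; exact: one Ax.
  - move=> x y [A FA Ax] [B FB By]; have [C [FC Cx Cy]] := common _ _ _ _ FA FB Ax By.
    by exists C => //; apply: subfieldB => //; have [] := Ffree _ FC.
  - move=> x y [A FA Ax] [B FB By]; have [C [FC Cx Cy]] := common _ _ _ _ FA FB Ax By.
    by exists C => //; apply: subfieldM => //; have [] := Ffree _ FC.
  by move=> x [A FA Ax]; exists A => //; apply: subfieldV => //; have [] := Ffree _ FA.
(* A maximal [G] without 1 would be empty, and the image of the rationals would be a strictly larger
   candidate. *)
have G1 : G 1.
  apply: contrapT => nG1; apply: (Gmax (range ratr)).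
    split=> [x Gx|G_range].
      by case: Gsub => one _ _ _; case: nG1; exact: one Gx.
    by apply: nG1; apply: G_range; exists 1; rewrite // rmorph1.
  split; last first.
    move=> _ [x _ <-]; rewrite /trisection_root => root_x; apply: (no_root x).
    apply: (fmorph_inj (@ratr R)).
    by rewrite rmorphB rmorphXn rmorphM /= ratr_nat.
  split.
  - by move=> _ _; exists 1; rewrite // rmorph1.
  - by move=> _ _ [x _ <-] [y _ <-]; exists (x - y); rewrite // rmorphB.
  - by move=> _ _ [x _ <-] [y _ <-]; exists (x * y); rewrite // rmorphM.
  - by move=> _ [x _ <-]; exists x^-1; rewrite // fmorphV.
exists G; split=> // z Gz2; apply: contrapT => nGz.
apply: (Gmax (adjoin_sqrt G z)).
  split=> [x Gx|adj_sub].
    by exists x, 0; split; infield Gsub G1; rewrite mul0r addr0.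
  by apply/nGz/adj_sub; exists 0, 1; split; infield Gsub G1; rewrite add0r mul1r.
split; first exact: subfield_adjoin_sqrt.
move=> x adj_x root_x.
have [||y Gy] := @trisection_root_adjoin_sqrt G (ratr a) z Gsub G1 _ Gz2 nGz.
- exact: subfield_ratr.
- by exists x.
exact: Gfree.
Qed.

(** * Straightedge and compass over a quadratically closed subfield *)

Section Closed.
Variables (G : set R) (Gsub : subfield G) (G1 : G 1).
Hypothesis Gsqrt : quadratically_closed G.

Definition over_point P := G P.1 /\ G P.2.

(* over_line and over_circle describe curves by equations with coefficients in G;
   over_circle does not ask for a positive radius. *)
Definition over_line D := exists a b c, [/\ G a, G b, G c,
  (a != 0) || (b != 0) & D = [set X : R * R | a * X.1 + b * X.2 = c]].

Definition over_circle D := exists a b c, [/\ G a, G b, G c &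
  D = [set X : R * R | X.1 ^+ 2 + X.2 ^+ 2 = a * X.1 + b * X.2 + c]].

Lemma over_line_through P Q :
  over_point P -> over_point Q -> P <> Q -> over_line (line P Q).
Proof.
case: P Q => [p1 p2] [q1 q2] [/= Gp1 Gp2] [/= Gq1 Gq2] PQ.
exists (q2 - p2), (p1 - q1), ((q2 - p2) * p1 + (p1 - q1) * p2).
split; infield Gsub G1.
  rewrite !subr_eq0 -negb_and; apply/negP => /andP[/eqP qp /eqP pq].
  by apply: PQ; rewrite qp pq.
by rewrite /line; apply/seteqP; split=> -[x y] /= h; lra.
Qed.

Lemma over_circle_through P Q :
  over_point P -> over_point Q -> over_circle (circle P Q).
Proof.
case: P Q => [p1 p2] [q1 q2] [/= Gp1 Gp2] [/= Gq1 Gq2].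
exists (2 * p1), (2 * p2), ((q1 - p1) ^+ 2 + (q2 - p2) ^+ 2 - p1 ^+ 2 - p2 ^+ 2).
split; infield Gsub G1.
by rewrite /circle /sqdist; apply/seteqP; split=> -[x y] /= h; lra.
Qed.

(** Completing the square, [2 * a * x + b] is a real square root of the discriminant, which lies in
    [G]. *)
Lemma quadratic_root_in a b c x : G a -> G b -> G c -> a != 0 ->
  a * x ^+ 2 + b * x + c = 0 -> G x.
Proof.
move=> Ga Gb Gc a_neq0 root_x.
have -> : x = ((2 * a * x + b) - b) / (2 * a) by field.
suff: G (2 * a * x + b) by move=> Gy; infield Gsub G1.
apply: Gsqrt; have -> : (2 * a * x + b) ^+ 2 = b ^+ 2 - 4 * a * c.
  by apply/eqP; rewrite -subr_eq0; apply/eqP; rewrite -[RHS](mulr0 (4 * a)) -root_x; ring.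
by infield Gsub G1.
Qed.

Lemma over_line_circle_meet D E X :
  over_line D -> over_circle E -> D X -> E X -> over_point X.
Proof.
move=> [a [b [c [Ga Gb Gc ab ->]]]] [e [f [g [Ge Gf Gg ->]]]].
case: X => x y /= lX cX; rewrite /over_point /=.
have [a0|a_neq0] := eqVneq a 0.
  have b_neq0 : b != 0 by move: ab; rewrite a0 eqxx.
  have yE : y = c / b.
    apply: (mulfI b_neq0); rewrite mulrCA divff // mulr1.
    by move: lX; rewrite a0 mul0r add0r.
  have Gy : G y by rewrite yE; infield Gsub G1.
  split=> //; apply: (@quadratic_root_in 1 (- e) (y ^+ 2 - f * y - g));
    rewrite ?oner_eq0 //; infield Gsub G1; lra.
have xE : x = c / a - b / a * y.
  by apply: (mulfI a_neq0); rewrite -lX; field.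
suff Gy : G y by split=> //; rewrite xE; infield Gsub G1.
pose m := b / a; pose k := c / a.
have Gm : G m by rewrite /m; infield Gsub G1.
have Gk : G k by rewrite /k; infield Gsub G1.
(* These are the coefficients of the quadratic in [y] obtained by substituting [x = k - m * y] into
   the circle; the leading one is positive. *)
apply: (@quadratic_root_in (1 + m ^+ 2) (e * m - f - 2 * k * m)
  (k ^+ 2 - e * k - g)); infield Gsub G1.
  by rewrite gt_eqF // ltr_pwDl // sqr_ge0.
by move: cX; rewrite xE -/m -/k => /eqP; rewrite -subr_eq0 => /eqP <-; ring.
Qed.

Lemma over_line_line_meet D E X :
  over_line D -> over_line E -> D <> E -> D X -> E X -> over_point X.
Proof.
move=> [a [b [c [Ga Gb Gc ab ->]]]] [a' [b' [c' [Ga' Gb' Gc' ab' ->]]]].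
case: X => x y DE /= DX EX; pose det := a * b' - a' * b.
have [det0|det_neq0] := eqVneq det 0; last first.
  split=> /=.
    (* Cramer's rule gives both coordinates. *)
    have -> : x = (c * b' - c' * b) / det.
      by apply: (mulfI det_neq0); rewrite mulrCA divff // -DX -EX /det; ring.
    by rewrite /det; infield Gsub G1.
  have -> : y = (a * c' - a' * c) / det.
    by apply: (mulfI det_neq0); rewrite mulrCA divff // -DX -EX /det; ring.
  by rewrite /det; infield Gsub G1.
(* The curves are parallel lines sharing X, hence equal. *)
case: DE; rewrite -DX -EX.
have key a1 b1 a2 b2 u v : (a1 != 0) || (b1 != 0) -> a1 * b2 - a2 * b1 = 0 ->
    a1 * u + b1 * v = 0 -> a2 * u + b2 * v = 0 :> R.
  move=> + d0 uv; case/orP=> neq0; apply: (mulfI neq0).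
    transitivity (a2 * (a1 * u + b1 * v) + (a1 * b2 - a2 * b1) * v); first ring.
    by rewrite uv d0; ring.
  transitivity (b2 * (a1 * u + b1 * v) - (a1 * b2 - a2 * b1) * u); first ring.
  by rewrite uv d0; ring.
have det0' : a' * b - a * b' = 0 by rewrite -[RHS]oppr0 -det0 /det; ring.
apply/seteqP; split=> -[u v] /= h.
  by have := key _ _ _ _ (u - x) (v - y) ab det0; lra.
by have := key _ _ _ _ (u - x) (v - y) ab' det0'; lra.
Qed.

(** Subtracting the equations gives the radical axis, which reduces the claim to a line and a
    circle. If its coefficients vanished, the circles would be concentric, and sharing [X] they
    would coincide. *)
Lemma over_circle_circle_meet D E X :
  over_circle D -> over_circle E -> D <> E -> D X -> E X -> over_point X.
Proof.
move=> oD oE; have [a [b [c [Ga Gb Gc DE]]]] := oD.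
have [a' [b' [c' [Ga' Gb' Gc' EE]]]] := oE => neqDE DX EX.
pose radical : set (R * R) := [set X | (a - a') * X.1 + (b - b') * X.2 = c' - c].
have rX : radical X by move: DX EX; rewrite DE EE /radical /=; lra.
apply: (@over_line_circle_meet radical D) => //.
exists (a - a'), (b - b'), (c' - c); split=> //; infield Gsub G1.
rewrite !subr_eq0 -negb_and; apply/negP => /andP[/eqP aa /eqP bb].
apply: neqDE; rewrite DE EE aa bb; suff -> : c = c' by [].
by move: rX; rewrite /radical /= aa bb; lra.
Qed.

Scheme constructible_mut := Minimality for constructible Sort Prop
  with drawable_mut := Minimality for drawable Sort Prop.

(** Mutual induction: points keep their coordinates in [G] while drawn curves keep equations with
    coefficients in [G]. *)
Lemma constructible_over (S : set (R * R)) :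
  S `<=` over_point -> constructible S `<=` over_point.
Proof.
move=> SG; apply: (@constructible_mut R S over_point
  (fun D => over_line D \/ over_circle D)) => //.
- move=> D E X _ [oD|oD] _ [oE|oE] DE DX EX.
  + exact: over_line_line_meet DX EX.
  + exact: over_line_circle_meet DX EX.
  + exact: over_line_circle_meet EX DX.
  + exact: over_circle_circle_meet DX EX.
- by move=> P Q _ GP _ GQ PQ; left; exact: over_line_through.
- by move=> P Q _ GP _ GQ PQ; right; exact: over_circle_through.
Qed.

End Closed.

(** * Triple angle formula and trisection numbers *)

Lemma cos_triple (x : R) : cos (3 * x) = 4 * cos x ^+ 3 - 3 * cos x.
Proof.
have -> : 3 * x = x *+ 2 + x by rewrite -mulr_natl; ring.
rewrite cosD cos_mulr2n sin_mulr2n.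
rewrite (_ : (cos x * sin x) *+ 2 * sin x = 2 * cos x * sin x ^+ 2); last by ring.
by rewrite sin2cos2; ring.
Qed.

Lemma no_rational_root_notin_Tri (a : rat) :
  (forall x : rat, x ^+ 3 - 3 * x <> a) -> ~ Tri R (ratr a).
Proof.
move=> /exists_quadratically_closed_subfield[G [Gsub G1 Gsqrt Gfree]].
move=> [alpha tri_alpha cosE].
have Gcos : G (cos alpha).
  have -> : cos alpha = ratr a / 2 by rewrite -cosE; field.
  by apply: (subfield_div Gsub); [exact: subfield_ratr | exact: subfield_nat].
have G0 := subfield0 Gsub G1.
(* Only the cosine is determined by [a]; the sine is a real square root of [1 - cos alpha ^+ 2], so
   it lies in [G] whatever its sign. *)
have Gsin : G (sin alpha) by apply: Gsqrt; rewrite sin2cos2; infield Gsub G1.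
have [|Gcos3 _] := constructible_over Gsub G1 Gsqrt _ tri_alpha.
  by move=> X /= [[->|->]|->].
apply: (Gfree (2 * cos (alpha / 3))); first by infield Gsub G1.
rewrite /trisection_root -cosE (_ : alpha = 3 * (alpha / 3)); last by field.
by rewrite cos_triple (_ : 3 * (alpha / 3) / 3 = alpha / 3); [ring|field].
Qed.

End Constructible.

Theorem proposition3p2 (R : realType) (a : rat)
  (a_bounds : -2 <= a <= 2) (a_neq0 : a != 0)
  (a_square : exists b : rat, a = b ^+ 2) :
  ~ Tri R (ratr a).
Proof.
case: a_square => b ab; apply: no_rational_root_notin_Tri => x; rewrite ab.
by apply: no_rational_point; move: a_neq0; rewrite ab expf_eq0.
Qed.
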